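(* Let $K$ be a field, $S=K[x_1,\ldots,x_n]$, and let $I\subset S$ be a monomial ideal which is componentwise of Veronese type. Then $I$ has linear quotients.
   Context: For a monomial ideal $I$, $G(I)$ denotes its unique minimal set of monomial generators, and $\deg_{x_i}(u)$ is the exponent of $x_i$ in the monomial $u$. Given positive integers $d,a_1,\ldots,a_n$, let $I_{(d;a_1,\ldots,a_n)}\subset S$ be the monomial ideal generated by all monomials $u\in S$ of degree $d$ with $\deg_{x_i}(u)\leq a_i$ for all $i=1,\ldots,n$. Monomial ideals of this form are called ideals of Veronese type. For a monomial ideal $I$, $I_{\langle j\rangle}$ denotes the ideal generated by all monomials of degree $j$ in $I$. $I$ is componentwise of Veronese type if $I_{\langle j\rangle}$ is of Veronese type for all $j$ with $I_{\langle j\rangle}\neq 0$. A monomial ideal $L$ has linear quotients if $G(L)$ can be ordered $u_1,\ldots,u_m$ such that for each $i=2,\ldots,m$ the colon ideal $(u_1,\ldots,u_{i-1}):u_i$ is generated by a subset of the variables (the generators are not required to have the same degree). *)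

(* Defs.v *)
From mathcomp Require Import all_boot all_algebra mpoly.

Set Implicit Arguments.
Unset Strict Implicit.
Unset Printing Implicit Defensive.

Import GRing.Theory.
Local Open Scope ring_scope.

(* Ideals of K[x_1, ..., x_n] are Prop-valued predicates compared
   extensionally: MathComp's [idealr] is boolean-valued and excludes the unit
   ideal.  The variables are indexed from 0, and a monomial is identified with
   its exponent vector m : 'X_{1..n}, so that deg_{x_i} is m i. *)
Definition eq_ideal (K : fieldType) (n : nat) (I J : {mpoly K[n]} -> Prop) :
    Prop :=
  forall p, I p <-> J p.

Definition zero_ideal (K : fieldType) (n : nat) : {mpoly K[n]} -> Prop :=
  fun p => p = 0.

Definition ideal_gen (K : fieldType) (n : nat) (A : {mpoly K[n]} -> Prop) :
    {mpoly K[n]} -> Prop :=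
  fun p => exists s : seq ({mpoly K[n]} * {mpoly K[n]}),
    (forall t, t \in s -> A t.2) /\ p = \sum_(t <- s) t.1 * t.2.

Definition mon_ideal (K : fieldType) (n : nat) (M : 'X_{1..n} -> Prop) :
    {mpoly K[n]} -> Prop :=
  ideal_gen (fun p => exists2 m, M m & p = 'X_[m]).

Definition var_ideal (K : fieldType) (n : nat) (V : {set 'I_n}) :
    {mpoly K[n]} -> Prop :=
  ideal_gen (fun p => exists2 i, i \in V & p = 'X_i).

Definition colon (K : fieldType) (n : nat) (J : {mpoly K[n]} -> Prop)
    (f : {mpoly K[n]}) : {mpoly K[n]} -> Prop :=
  fun p => J (p * f).

Definition is_monomial_ideal (K : fieldType) (n : nat)
    (I : {mpoly K[n]} -> Prop) : Prop :=
  exists M : 'X_{1..n} -> Prop, eq_ideal I (mon_ideal M).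

(* G is the minimal set of monomial generators G(I), minimality being with
   respect to inclusion. *)
Definition is_min_gens (K : fieldType) (n : nat) (I : {mpoly K[n]} -> Prop)
    (G : 'X_{1..n} -> Prop) : Prop :=
  eq_ideal I (mon_ideal G) /\
  forall G' : 'X_{1..n} -> Prop,
    (forall m, G' m -> G m) -> eq_ideal I (mon_ideal G') ->
    forall m, G m -> G' m.

Definition veronese (K : fieldType) (n d : nat) (a : 'I_n -> nat) :
    {mpoly K[n]} -> Prop :=
  mon_ideal (fun m => mdeg m = d /\ forall i, (m i <= a i)%N).

Definition is_veronese_type (K : fieldType) (n : nat)
    (J : {mpoly K[n]} -> Prop) : Prop :=
  exists (d : nat) (a : 'I_n -> nat),
    [/\ (0 < d)%N, forall i, (0 < a i)%N & eq_ideal J (veronese d a)].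

(* I_<j> *)
Definition component (K : fieldType) (n : nat) (I : {mpoly K[n]} -> Prop)
    (j : nat) : {mpoly K[n]} -> Prop :=
  mon_ideal (fun m => mdeg m = j /\ I 'X_[m]).

Definition componentwise_veronese_type (K : fieldType) (n : nat)
    (I : {mpoly K[n]} -> Prop) : Prop :=
  forall j : nat, ~ eq_ideal (component I j) (@zero_ideal K n) ->
    is_veronese_type (component I j).

Definition has_linear_quotients (K : fieldType) (n : nat)
    (L : {mpoly K[n]} -> Prop) : Prop :=
  exists u : seq 'X_{1..n},
    [/\ uniq u, is_min_gens L (fun m => m \in u) &
      forall i : nat, (0 < i < size u)%N ->
        exists V : {set 'I_n},
          eq_ideal (colon (mon_ideal (fun m => m \in take i u))
                          'X_[nth 0%MM u i])
                   (@var_ideal K n V)].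

(* Main.v *)
Require Import Defs.
From mathcomp Require Import all_boot all_order all_algebra mpoly zify.
From Stdlib Require Import Classical_Prop.

Set Implicit Arguments.
Unset Strict Implicit.
Unset Printing Implicit Defensive.

Import Order.TTheory GRing.Theory.

(** Write [M_j] for the set of monomials of degree [j] in [I], and [b_j i] for
    the largest exponent of [x_i] in [M_j] (0 if [M_j] is empty).  The
    hypothesis on [I] says that a nonempty [M_j] consists of all monomials of
    degree [j] with exponents at most [b_j] ([veronese_boxed]).

    By Dickson's lemma ([dickson]) the minimal monomial generators of [I] form
    a finite antichain [G].  They are ordered by increasing degree; among
    generators of the same degree [j], those closest to the preceding component
    come first, that is, those whose gcd with the monomial of exponent [b_(j-1)]
    has the largest degree; the remaining ties are broken by decreasing
    lexicographic order.

    Colon ideals by a monomial are computed on monomials, so linear quotients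
    amount to an exchange property ([linear_colon], [exchange]): if the
    generator [v] precedes [u], then for some [k] with [v_k > u_k] the monomial
    [x_k u] is divisible by a generator preceding [u].  Put [j = deg u] and
    [c = b_(j-1)].

    - If some [k] satisfies [u_k < v_k] and [u_k < c_k], choose [l] with
      [u_l > c_l]; it exists, for otherwise removing one variable from [u] would
      leave a monomial of [M_(j-1)] and [u] would not be minimal.  Then
      [w = x_k u / x_l] lies in [M_j], as [w_k = u_k + 1 <= c_k <= b_j k], and
      its gcd with [x^c] is larger than that of [u]; so [w], or a generator of
      smaller degree dividing it, precedes [u] ([exchange_below]).
    - If [deg v < j], any [k] with [v_k > u_k] is of this kind, because
      [v x_k^t] belongs to [M_(j-1)] for the appropriate [t], whence
      [v_k <= c_k].
    - Otherwise [v] has degree [j] and [min(v_i, c_i) <= min(u_i, c_i)] for all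
      [i].  As [v] precedes [u], the sums over [i] are in the opposite order, so
      all these are equalities and [v] is lexicographically larger than [u].
      Let [k] be the first index where [u] and [v] differ, and [l] any index
      with [v_l < u_l].  Both [u_k >= c_k] and [u_l > v_l >= c_l], so
      [w = x_k u / x_l] has the same gcd degree as [u] and is lexicographically
      larger; it lies in [M_j] since [w_k <= v_k]. *)

(** * Dickson's lemma *)

Lemma mdeg_lem n (g m : 'X_{1..n}) : (g <= m)%MM -> mdeg g <= mdeg m.
Proof. by move=> le_gm; rewrite -(submK le_gm) mdegD leq_addl. Qed.

Lemma lem_mdeg_eq n (g m : 'X_{1..n}) :
  (g <= m)%MM -> mdeg m <= mdeg g -> g = m.
Proof.
move=> le_gm; rewrite -{1}(submK le_gm) mdegD -{2}[mdeg g]add0n leq_add2r.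
by rewrite leqn0 mdeg_eq0 => /eqP d0; rewrite -(submK le_gm) d0 add0m.
Qed.

(** Equivalently, the monomial ideal spanned by [P] is generated by finitely
    many elements of [P]. *)
Definition fin_dominated n (P : 'X_{1..n} -> Prop) :=
  exists s : seq 'X_{1..n}, (forall g, g \in s -> P g) /\
    forall m, P m -> exists2 g, g \in s & (g <= m)%MM.

Lemma fin_dominated_bigcup n (T : eqType) (xs : seq T)
    (Q : T -> 'X_{1..n} -> Prop) :
    (forall x, x \in xs -> fin_dominated (Q x)) ->
  fin_dominated (fun m => exists2 x, x \in xs & Q x m).
Proof.
elim: xs => [|x xs IH] finQ; first by exists [::]; split=> // m [].
have [s [sQ domQ]] := finQ x (mem_head _ _).
have [y yxs|s' [sQ' domQ']] := IH; first by apply: finQ; rewrite inE yxs orbT.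
exists (s ++ s'); split=> [g|m [y]].
  rewrite mem_cat => /orP[/sQ Qg|/sQ' [y yxs Qg]].
    by exists x => //; exact: mem_head.
  by exists y => //; rewrite inE yxs orbT.
rewrite inE => /orP[/eqP-> /domQ [g gs le_gm]|yxs Qm].
  by exists g; rewrite // mem_cat gs.
have [|g gs le_gm] := domQ' m; first by exists y.
by exists g; rewrite // mem_cat gs orbT.
Qed.

(** The induction is on the number of exponents that vary over [P], those with
    index outside [F].  Fix [m0] in [P]: an element of [P] that is not a
    multiple of [m0] has some exponent [m i] below [m0 i].  There are finitely
    many such pairs [(i, m i)], and prescribing one of them leaves one varying
    exponent fewer. *)
Lemma dickson_fixed n (F : {set 'I_n}) (P : 'X_{1..n} -> Prop) :
  (forall m m', P m -> P m' -> {in F, m =1 m'}) -> fin_dominated P.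
Proof.
have [k] := ubnP #|~: F|; elim: k => // k IH in F P * => leF agree.
have [[m0 Pm0]|noP] := classic (exists m, P m); last first.
  by exists [::]; split=> // m Pm; case: noP; exists m.
pose xs := [seq (i, t) | i <- enum (~: F), t <- iota 0 (m0 i)].
have [[i t]|s [sP domP]] :=
  @fin_dominated_bigcup n _ xs (fun x m => P m /\ m x.1 = x.2).
  case/allpairsPdep=> [j [t' [+ _ [-> _]]]]; rewrite mem_enum => jF.
  apply: (IH (j |: F)) => [|m m' [Pm /= mi] [Pm' /= m'i] l].
    rewrite setCU setIC -setDE -ltnS (leq_trans _ leF) //.
    by rewrite [X in _ < X.+1](cardsD1 j) jF ltnS.
  by rewrite in_setU1 => /orP[/eqP->|]; [rewrite mi m'i|exact: agree].
exists (m0 :: s); split=> [g|m Pm].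
  by rewrite inE => /orP[/eqP->//|/sP[x _ []]].
have [le_m0m|/forallPn [i lt_mi]] := boolP (m0 <= m)%MM.
  by exists m0 => //; exact: mem_head.
have [|g gs le_gm] := domP m; last by exists g; rewrite // inE gs orbT.
exists (i, m i) => //; apply/allpairsPdep; exists i, (m i); split=> //.
  rewrite mem_enum in_setC; apply/negP=> /(agree _ _ Pm0 Pm) e.
  by rewrite e leqnn in lt_mi.
by rewrite mem_iota add0n ltnNge.
Qed.

(** Membership of the monomial [m] in the ideal generated by [G]. *)
Definition divides_some n (G : seq 'X_{1..n}) (m : 'X_{1..n}) :=
  has (fun g => (g <= m)%MM) G.

Lemma dickson n (P : 'X_{1..n} -> Prop) :
  exists G : seq 'X_{1..n},
    [/\ uniq G, {in G &, forall g h, (g <= h)%MM -> g = h},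
        forall g, g \in G -> P g
      & forall m, P m -> exists2 g, g \in G & (g <= m)%MM].
Proof.
have [|s [sP domP]] := @dickson_fixed n set0 P.
  by move=> m m' _ _ i; rewrite inE.
pose minimal g := all (fun h => (h <= g)%MM ==> (h == g)) s.
exists (filter minimal (undup s)); split.
- exact/filter_uniq/undup_uniq.
- move=> g h; rewrite !mem_filter !mem_undup.
  by move=> /andP[_ gs] /andP[/allP/(_ g gs)] + _ le_gh; rewrite le_gh => /eqP.
- by move=> g; rewrite mem_filter mem_undup => /andP[_ /sP].
move=> m /domP [g + le_gm]; have [k] := ubnP (mdeg g).
elim: k => // k IH in g le_gm *; rewrite ltnS => le_gk gs.
have [ming|] := boolP (minimal g).
  by exists g; rewrite // mem_filter ming mem_undup.
case/allPn=> h hs; rewrite negb_imply => /andP[le_hg ne_hg].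
apply: (IH h) => //; first exact: lepm_trans le_hg le_gm.
rewrite (leq_trans _ le_gk) // ltnNge; apply: contraNN ne_hg => le_d.
by rewrite (lem_mdeg_eq le_hg le_d).
Qed.

(** * The order on the generators *)

(** This is 0 when [p] has no monomial of degree [j], so that a positive value
    certifies that there is one; [ltn_maxexp] is used in this way. *)
Definition maxexp n (p : pred 'X_{1..n}) (j : nat) (i : 'I_n) : nat :=
  \max_(m : 'X_{1..n < j.+1} | p m && (mdeg m == j)) bmnm m i.

Lemma leq_maxexp n (p : pred 'X_{1..n}) m i : p m -> m i <= maxexp p (mdeg m) i.
Proof.
move=> pm.
apply: (@leq_bigmax_cond _ _ (fun m' : 'X_{1..n < (mdeg m).+1} => bmnm m' i)
  (BMultinom (ltnSn (mdeg m)))).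
by rewrite /= pm eqxx.
Qed.

Lemma ltn_maxexp n (p : pred 'X_{1..n}) j i t :
  t < maxexp p j i -> exists m, [/\ p m, mdeg m = j & t < m i].
Proof.
move=> lt_t; case: (pickP (fun m : 'X_{1..n < j.+1} =>
    [&& p m, mdeg m == j & t < bmnm m i])) => [m /and3P[pm /eqP dm lt_tm]|nom].
  by exists m.
suff: maxexp p j i <= t by rewrite leqNgt lt_t.
apply/bigmax_leqP=> m /andP[pm dm]; rewrite leqNgt.
by have := nom m; rewrite /= pm dm => /negbT.
Qed.

(** The degree of the gcd of [m] and the monomial with exponents [c]. *)
Definition gcd_deg n (c : 'I_n -> nat) (m : 'X_{1..n}) :=
  \sum_i minn (m i) (c i).

Definition prev_gcd_deg n (p : pred 'X_{1..n}) (m : 'X_{1..n}) :=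
  gcd_deg (maxexp p (mdeg m).-1) m.

(** Generators are sorted by increasing key, hence the dual orders on the last
    two components.  The order on monomials of equal degree is lexicographic. *)
Definition quot_key n (p : pred 'X_{1..n}) (m : 'X_{1..n}) :
    (nat *l nat^d *l 'X_{1..n}^d)%type :=
  (mdeg m, prev_gcd_deg p m : nat^d, m : 'X_{1..n}^d).

Lemma quot_key_inj n (p : pred 'X_{1..n}) : injective (quot_key p).
Proof. by move=> u v []. Qed.

Lemma quot_key_ltE n (p : pred 'X_{1..n}) u v :
  (quot_key p v < quot_key p u)%O = (mdeg v < mdeg u) ||
    (mdeg v == mdeg u) && ((prev_gcd_deg p u < prev_gcd_deg p v) ||
      (prev_gcd_deg p v == prev_gcd_deg p u) && (u < v)%O).
Proof.
rewrite /quot_key !ltxi_pair !lexi_pair !ltEdual !leEdual !leEnat.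
by case: (ltngtP (mdeg v)) => //= _; case: ltngtP.
Qed.

(** The Veronese condition in every degree, with the exponent bounds taken
    minimal. *)
Definition boxed n (p : pred 'X_{1..n}) := forall m0 m,
  p m0 -> mdeg m = mdeg m0 -> (forall i, m i <= maxexp p (mdeg m) i) -> p m.

Lemma swapE n (u : 'X_{1..n}) k l i :
  (u + U_(k) - U_(l))%MM i = u i + (k == i) - (l == i).
Proof. by rewrite mnmBE mnmDE !mnm1E. Qed.

Lemma mdeg_swap n (u : 'X_{1..n}) k l :
  0 < u l -> mdeg (u + U_(k) - U_(l))%MM = mdeg u.
Proof.
move=> ul; have le_l : (U_(l) <= u + U_(k))%MM.
  by rewrite lep1mP mnmDE -lt0n addn_gt0 ul.
by apply: (@addIn 1); rewrite -{1}(mdeg1 l) -mdegD submK // mdegD mdeg1.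
Qed.

(** * The exchange property *)

Section Exchange.
Variables (n : nat) (G : seq 'X_{1..n}).
Let p := divides_some G.
Hypothesis antiG : {in G &, forall g h, (g <= h)%MM -> g = h}.
Hypothesis box : boxed p.

Lemma divides_some_lem m m' : p m -> (m <= m')%MM -> p m'.
Proof.
case/hasP=> g gG le_gm le_mm'; apply/hasP; exists g => //.
exact: lepm_trans le_mm'.
Qed.

Lemma divides_some_gen g : g \in G -> p g.
Proof. by move=> gG; apply/hasP; exists g; rewrite ?lepm_refl. Qed.

(** Exchanges produce elements [w] of the ideal that need not be generators.
    This costs nothing: a generator dividing [w] is [w] itself or has smaller
    degree, so it precedes [u] if [w] does. *)
Lemma gen_below u w k : p w -> mdeg w = mdeg u -> (w <= u + U_(k))%MM ->
    (quot_key p w < quot_key p u)%O ->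
  exists g,
    [/\ g \in G, (quot_key p g < quot_key p u)%O & (g <= u + U_(k))%MM].
Proof.
case/hasP=> g gG le_gw dw le_wu lt_wu; exists g.
split=> //; last exact: lepm_trans le_wu.
have [lt_d|ge_d] := ltnP (mdeg g) (mdeg w).
  by rewrite quot_key_ltE -dw lt_d.
by rewrite (lem_mdeg_eq le_gw ge_d).
Qed.

Lemma maxexp_succ j k t : t < maxexp p j k -> t.+1 < maxexp p j.+1 k.
Proof.
case/ltn_maxexp=> m [pm <- lt_tm]; apply: leq_ltn_trans lt_tm _.
have := leq_maxexp k (divides_some_lem pm (lem_addr m U_(k))).
by rewrite mdegD mdeg1 addn1 mnmDE mnm1E eqxx addn1.
Qed.

(** Multiplying [u] by [x_k] increases the gcd with the previous box, and a
    variable [x_l] by which [u] leaves that box can be removed without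
    decreasing it. *)
Lemma exchange_below u k :
    u \in G -> 0 < mdeg u -> u k < maxexp p (mdeg u).-1 k ->
  exists g,
    [/\ g \in G, (quot_key p g < quot_key p u)%O & (g <= u + U_(k))%MM].
Proof.
move=> uG du lt_uk; set c := maxexp p _ in lt_uk.
have [/forallP le_uc|/forallPn [l]] := boolP [forall l, u l <= c l].
  (* The preceding component is nonempty because its bound at k is positive; if
     u is in its box, then u is not a minimal generator. *)
  have [m [pm dm _]] := ltn_maxexp lt_uk.
  have [l ul] : exists l, 0 < u l.
    apply/existsP; apply: contraTT du; rewrite negb_exists => /forallP u0.
    by rewrite mdegE big1 // => i _; apply/eqP; rewrite -leqn0 leqNgt.
  have le_lu : (U_(l) <= u)%MM by rewrite lep1mP -lt0n.
  have du' : mdeg (u - U_(l))%MM = (mdeg u).-1.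
    by rewrite -{2}(submK le_lu) mdegD mdeg1 addn1.
  have /hasP[g gG le_gu] : p (u - U_(l))%MM.
    apply: (box pm) => [|i]; first by rewrite du'.
    by rewrite du' (leq_trans _ (le_uc i)) // mnmBE leq_subr.
  have eq_gu := antiG gG uG (lepm_trans le_gu (lem_subr _ _)).
  have := mdeg_lem le_gu; rewrite eq_gu du'.
  by case: (mdeg u) du => // d _; rewrite ltnn.
rewrite -ltnNge => lt_cl.
have ne_kl : k != l by apply: contraTneq lt_cl => <-; rewrite -leqNgt ltnW.
have ul : 0 < u l by apply: leq_ltn_trans lt_cl.
apply: (@gen_below u (u + U_(k) - U_(l))%MM k) => //; rewrite ?mdeg_swap ?lem_subr //.
  apply: (box (divides_some_gen uG)) => [|i]; rewrite mdeg_swap // swapE.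
  have [<-|ne_ki] := eqVneq k i; last first.
    by rewrite addn0 (leq_trans (leq_subr _ _)) ?leq_maxexp ?divides_some_gen.
  by rewrite eq_sym (negbTE ne_kl) addn1 subn0 -(prednK du) ltnW ?maxexp_succ.
rewrite quot_key_ltE mdeg_swap // eqxx ltnn /= /prev_gcd_deg mdeg_swap // -/c.
apply/orP; left; rewrite /gcd_deg (bigD1 k) //= [X in _ < X](bigD1 k) //= -addSn.
apply: leq_add; first by rewrite swapE eqxx eq_sym (negbTE ne_kl); lia.
apply: leq_sum => i ne_ik; rewrite swapE [k == i]eq_sym (negbTE ne_ik).
by have [<-|_] := eqVneq l i; lia.
Qed.

(** When [exchange_below] does not apply, [u] and [v] have the same degree and
    the same gcd with the previous box, and where their exponents differ both
    are at least those of the box.  Exchanging two such exponents keeps the gcd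
    degree, which leaves the lexicographic order to decide. *)
Lemma exchange u v :
    u \in G -> v \in G -> (quot_key p v < quot_key p u)%O ->
  exists k, u k < v k /\ exists g,
    [/\ g \in G, (quot_key p g < quot_key p u)%O & (g <= u + U_(k))%MM].
Proof.
move=> uG vG lt_vu.
have ne_vu : v != u by apply: contraTneq lt_vu => ->; rewrite ltxx.
have du : 0 < mdeg u.
  rewrite lt0n mdeg_eq0; apply: contraNneq ne_vu => u0.
  rewrite eq_sym; apply/eqP/antiG => //; rewrite u0.
  by apply/mnm_lepP=> i; rewrite mnm0E.
pose c := maxexp p (mdeg u).-1.
have [/existsP [k /andP[up_k lt_c]]|] :=
  boolP [exists k, (u k < v k) && (u k < c k)].
  by exists k; split=> //; exact: exchange_below.
rewrite negb_exists => /forallP nolow.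
move: lt_vu; rewrite quot_key_ltE => /orP[lt_d|/andP[/eqP eq_d]].
  have /forallPn [k] : ~~ (v <= u)%MM by apply: contra ne_vu => /antiG->.
  rewrite -ltnNge => lt_k; have := nolow k; rewrite lt_k /=.
  (* A power of x_k raises v to degree mdeg u - 1, so that v k is bounded by
     c k; hence u k < c k, which was excluded. *)
  have dv' : mdeg (v + U_(k) *+ ((mdeg u).-1 - mdeg v))%MM = (mdeg u).-1.
    by rewrite mdegD mdegMn mdeg1 mul1n subnKC // -ltnS prednK.
  case/negP; apply: (leq_trans lt_k); rewrite /c -dv'.
  apply: leq_trans (leq_maxexp k _); first by rewrite mnmDE leq_addr.
  exact: divides_some_lem (divides_some_gen vG) (lem_addr _ _).
rewrite /prev_gcd_deg eq_d -/c => earlier.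
have le_min i : minn (v i) (c i) <= minn (u i) (c i).
  by have := nolow i; lia.
have ge_sum : gcd_deg c u <= gcd_deg c v.
  by case/orP: earlier => [/ltnW|/andP[/eqP->]].
have eq_min i : minn (v i) (c i) = minn (u i) (c i).
  apply/eqP; rewrite eqn_leq le_min /=.
  move: ge_sum; rewrite /gcd_deg (bigD1 i) //= [X in _ <= X](bigD1 i) //=.
  set rest_u := \sum_(j < n | j != i) minn (u j) (c j) => le_sum.
  rewrite -(leq_add2r rest_u) (leq_trans le_sum) // leq_add2l.
  exact: leq_sum.
have eq_sum : gcd_deg c v = gcd_deg c u by apply: eq_bigr => i _.
move: earlier; rewrite eq_sum ltnn eqxx /= => /ltmcP -/(_ (esym eq_d)) [k eq_lt lt_k].
exists k; split=> //.
have [l lt_l] : exists l, v l < u l.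
  apply/existsP; apply: contraNT ne_vu; rewrite negb_exists => /forallP no.
  apply/eqP/esym/lem_mdeg_eq; last by rewrite eq_d.
  by apply/mnm_lepP=> i; rewrite leqNgt.
have lt_kl : k < l.
  rewrite ltnNge leq_eqVlt; apply/negP=> /orP[/eqP/val_inj e|/eq_lt e].
    by move: lt_l; rewrite e ltnNge ltnW.
  by move: lt_l; rewrite e ltnn.
have ne_kl : k != l by rewrite neq_ltn lt_kl.
have ul : 0 < u l by apply: leq_ltn_trans lt_l.
apply: (@gen_below u (u + U_(k) - U_(l))%MM k) => //; rewrite ?mdeg_swap ?lem_subr //.
  apply: (box (divides_some_gen uG)) => [|i]; rewrite mdeg_swap // swapE.
  have [<-|ne_ki] := eqVneq k i; last first.
    by rewrite addn0 (leq_trans (leq_subr _ _)) ?leq_maxexp ?divides_some_gen.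
  rewrite eq_sym (negbTE ne_kl) addn1 subn0 (leq_trans lt_k) // -eq_d.
  by rewrite leq_maxexp ?divides_some_gen.
rewrite quot_key_ltE mdeg_swap // eqxx ltnn /= /prev_gcd_deg mdeg_swap // -/c.
apply/orP; right; apply/andP; split.
  (* c k <= u k and c l <= v l < u l: the exchange only moves exponents
     outside the box. *)
  apply/eqP/eq_bigr=> i _; rewrite swapE.
  have := nolow k; rewrite lt_k /= => le_c.
  have [<-|_] := eqVneq k i; first by rewrite eq_sym (negbTE ne_kl); lia.
  by have [<-|_] := eqVneq l i; [have := eq_min l; lia|lia].
apply/ltmcP; first by rewrite mdeg_swap.
exists k => [j lt_jk|]; rewrite swapE ?eqxx; last first.
  by rewrite eq_sym (negbTE ne_kl); lia.
have /negbTE -> : k != j by rewrite neq_ltn lt_jk orbT.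
have /negbTE -> : l != j by rewrite neq_ltn (ltn_trans lt_jk) ?orbT.
by rewrite addn0 subn0.
Qed.

End Exchange.

(** * Monomial ideals and their colon ideals *)

Section MonomialIdeals.
Variables (K : fieldType) (n : nat).
Implicit Types (M : 'X_{1..n} -> Prop) (p : {mpoly K[n]}).
Local Open Scope ring_scope.

Lemma mem_mon_ideal M p :
  mon_ideal M p <-> forall m, m \in msupp p -> exists2 g, M g & (g <= m)%MM.
Proof.
split=> [[s [sM ->]] m /msupp_sum_le /flattenP [ms /mapP[t + ->]]|].
  rewrite mem_filter => ts; have [g Mg ->] := sM _ ts.
  rewrite (perm_mem (msuppMX _ _)) => /mapP[m' _ ->].
  by exists g; rewrite ?lem_addr.
move=> domM; rewrite (mpolyE p); elim: (msupp p) domM => [|m r IH] domM.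
  by exists [::]; rewrite !big_nil.
have [m' m'r|s [sM eq_s]] := IH; first by apply: domM; rewrite inE m'r orbT.
have [g Mg le_gm] := domM m (mem_head _ _).
exists ((p@_m *: 'X_[m - g], 'X_[g]) :: s); split=> [t|].
  by rewrite inE => /orP[/eqP->|/sM//]; exists g.
by rewrite !big_cons eq_s -scalerAl -mpolyXD submK.
Qed.

Lemma mon_idealX M m :
  mon_ideal M ('X_[m] : {mpoly K[n]}) <-> exists2 g, M g & (g <= m)%MM.
Proof.
rewrite mem_mon_ideal msuppX; split=> [|domM m']; first by apply; rewrite inE.
by rewrite inE => /eqP->.
Qed.

Lemma mem_var_ideal (V : {set 'I_n}) p :
  var_ideal V p <-> forall m, m \in msupp p -> exists2 i, i \in V & (0 < m i)%N.
Proof.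
have -> : var_ideal V p <->
    mon_ideal (fun m => exists2 i, i \in V & m = U_(i)%MM) p.
  split=> -[s [sV ->]]; exists s; split=> // t /sV.
    by case=> i iV ->; exists U_(i)%MM => //; exists i.
  by case=> _ [i iV ->] ->; exists i.
rewrite mem_mon_ideal; split=> dom m /dom.
  by case=> _ [i iV ->]; rewrite lep1mP -lt0n; exists i.
by case=> i iV; rewrite lt0n -lep1mP; exists U_(i)%MM => //; exists i.
Qed.

Lemma monomial_idealP (I : {mpoly K[n]} -> Prop) p : is_monomial_ideal I ->
  I p <-> forall m, m \in msupp p -> I 'X_[m].
Proof.
case=> M eqI; rewrite eqI mem_mon_ideal.
by split=> dom m /dom => [|/eqI/mon_idealX//]; rewrite eqI mon_idealX.
Qed.

Lemma antichain_min_gens (I : {mpoly K[n]} -> Prop) (G : seq 'X_{1..n}) :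
    is_monomial_ideal I -> {in G &, forall g h, (g <= h)%MM -> g = h} ->
    (forall m, I 'X_[m] <-> divides_some G m) ->
  is_min_gens I (fun m => m \in G).
Proof.
move=> monI antiG genG; split=> [p|G' subG' eqI m mG].
  rewrite (monomial_idealP _ monI) mem_mon_ideal.
  split=> dom m /dom; rewrite genG; first by case/hasP=> g; exists g.
  by case=> g gG le_gm; apply/hasP; exists g.
have /eqI/mon_idealX [g G'g le_gm] : I 'X_[m] by rewrite genG divides_some_gen.
by rewrite -(antiG g m (subG' _ G'g) mG le_gm).
Qed.

(** The variables generating the colon ideal are those [x_k] with [x_k u] in
    the ideal generated by [W].  The exchange hypothesis makes each
    monomial [m] with [m u] in that ideal divisible by one of them, because
    [v] dividing [m u] and [v_k > u_k] force [m_k > 0]. *)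
Lemma linear_colon (W : seq 'X_{1..n}) (u : 'X_{1..n}) :
    (forall v, v \in W -> exists k,
       (u k < v k)%N /\ exists2 w, w \in W & (w <= u + U_(k))%MM) ->
  exists V : {set 'I_n},
    eq_ideal (colon (mon_ideal (fun m => m \in W)) ('X_[u] : {mpoly K[n]}))
             (var_ideal V).
Proof.
move=> exch; exists [set k | divides_some W (u + U_(k))%MM] => p.
rewrite /colon mem_mon_ideal mem_var_ideal; split=> dom m.
  move=> mp; have [|v vW le_v] := dom (u + m)%MM.
    by rewrite (perm_mem (msuppMX _ _)) map_f.
  have [k [lt_k [w wW le_w]]] := exch v vW.
  exists k; first by rewrite inE; apply/hasP; exists w.
  by move/mnm_lepP: le_v => /(_ k); rewrite mnmDE; lia.
rewrite (perm_mem (msuppMX _ _)) => /mapP[m' /dom [k]].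
rewrite inE => /hasP[w wW le_w] m'k ->; exists w => //.
apply: lepm_trans le_w _; apply/mnm_lepP=> i; rewrite !mnmDE mnm1E leq_add2l.
by case: eqP => // <-.
Qed.

(** The exponents [maxexp] reached in a component are at most any Veronese
    bounds [a] for it, so the box they define lies inside the component.  The
    Veronese degree [d] is the degree of the component since both ideals are
    generated in a single degree and nonzero. *)
Lemma veronese_boxed (I : {mpoly K[n]} -> Prop) (p : pred 'X_{1..n}) :
    (forall m, I 'X_[m] <-> p m) ->
  componentwise_veronese_type I -> boxed p.
Proof.
move=> Ip verI m0 m pm0 dm le_max.
have compE m' : component I (mdeg m0) 'X_[m'] -> mdeg m' = mdeg m0 -> p m'.
  case/mon_idealX=> g [dg Ig] le_gm dm'; apply/Ip.
  by rewrite -(lem_mdeg_eq le_gm) // dm' dg.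
have compI m' : p m' -> mdeg m' = mdeg m0 -> component I (mdeg m0) 'X_[m'].
  move=> pm' dm'; apply/mon_idealX.
  by exists m'; [split=> //; exact/Ip|exact: lepm_refl].
have [|d [a [_ _ eqV]]] := verI (mdeg m0).
  move=> /(_ 'X_[m0]) [/(_ (compI _ pm0 erefl)) X0 _].
  by have := msuppX K m0; rewrite X0 msupp0.
have dE : d = mdeg m0.
  have /eqV/mon_idealX [g [dg ga] le_g] := compI _ pm0 erefl.
  have /eqV/mon_idealX [h [dh _] le_h] : veronese d a ('X_[g] : {mpoly K[n]}).
    by apply/mon_idealX; exists g; rewrite ?lepm_refl.
  by apply/eqP; rewrite eqn_leq -{1}dg mdeg_lem //= -dh -dg mdeg_lem.
apply: compE => //; apply/eqV/mon_idealX; exists m; rewrite ?lepm_refl //.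
split=> [|i]; first by rewrite dm dE.
rewrite leqNgt; apply/negP=> lt_a.
have [m' [pm' dm' lt_m']] := ltn_maxexp (leq_trans lt_a (le_max i)).
have /eqV/mon_idealX [g [dg ga] le_g] := compI _ pm' (etrans dm' dm).
have := ga i; rewrite (lem_mdeg_eq le_g) ?dm' ?dm ?dg ?dE //.
by rewrite leqNgt lt_m'.
Qed.

End MonomialIdeals.

(** * Linear quotients *)

Theorem corollary3p7 (K : fieldType) (n : nat) (I : {mpoly K[n]} -> Prop)
    (hI : is_monomial_ideal I) (hV : componentwise_veronese_type I) :
  has_linear_quotients I.
Proof.
have [G [uG antiG GI domG]] := dickson (fun m => I 'X_[m])%R.
have genG m : (I 'X_[m])%R <-> divides_some G m.
  split=> [/domG[g gG le]|/hasP[g /GI Ig le]]; first by apply/hasP; exists g.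
  case: hI => M eqI; move: Ig; rewrite !eqI !mon_idealX => -[h Mh le_hg].
  by exists h => //; exact: lepm_trans le_hg le.
pose key := quot_key (divides_some G); pose r := relpre key <=%O.
have memu : sort r G =i G := mem_sort r G.
have antiu : {in sort r G &, forall g h, (g <= h)%MM -> g = h}.
  by move=> g h; rewrite !memu; exact: antiG.
have genu m : (I 'X_[m])%R <-> divides_some (sort r G) m.
  by rewrite genG /divides_some (eq_has_r memu).
have ltu : sorted <%O (map key (sort r G)).
  rewrite lt_sorted_uniq_le (map_inj_uniq (@quot_key_inj _ _)) sort_uniq uG /=.
  by rewrite sorted_map sort_sorted // => x y; apply: le_total.
exists (sort r G); split; first by rewrite sort_uniq.
  exact: antichain_min_gens.
move=> i /andP[_ lt_i]; apply: linear_colon; set u := nth _ _ i.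
have uG' : u \in G by rewrite -memu mem_nth.
have take_lt w : w \in take i (sort r G) = (w \in G) && (key w < key u)%O.
  rewrite -memu; have [ws|] := boolP (w \in sort r G); last first.
    by apply: contraNF; exact: mem_take.
  have iw := ws; rewrite -index_mem in iw; rewrite in_take //=.
  have := @lt_sorted_ltn_nth _ _ (key u) _ ltu (index w (sort r G)) i.
  rewrite !inE size_map => /(_ iw lt_i) <-.
  by rewrite !(nth_map 0%MM) // nth_index.
move=> v; rewrite take_lt => /andP[vG lt_vu].
have [k [lt_k [g [gG lt_gu le_g]]]] :=
  exchange antiG (veronese_boxed genG hV) uG' vG lt_vu.
by exists k; split=> //; exists g; rewrite // take_lt gG.
Qed.
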